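(* The correspondence $(-)^{\smile}$, which takes each continuous semilattice with zero $S$ to $S^\land$ and each pseudo-invertible ambiguous representation $R\subset S_1\times S_2$ to $R^{\smile}\subset S_2^\land\times S_1^\land$, is an involutive contravariant functor (a self-duality) in the category $\mathcal{S}em\mathcal{PR}$; here involutivity means that, under the isomorphisms $u_S:S\to S^{\land\land}$, the functor $(-)^{\smile\smile}$ is isomorphic to the identity functor, i.e. $(x,y)\in R\iff (u_{S_1}(x),u_{S_2}(y))\in R^{\smile\smile}$ for each arrow $R$ from $S_1$ to $S_2$. It is an extension of the functor $(-)^\land$ in $\mathcal{S}em_0$, i.e. $(If)^{\smile}=I(f^\land)$ for each arrow $f$ of $\mathcal{S}em_0$.
   Context: Order-theoretic conventions. A subset $A$ of a poset is directed if for all $x,y\in A$ there is $z\in A$ with $x\le z$, $y\le z$; non-emptiness is not required, so the empty set is directed. A dcpo is a poset in which all directed subsets have suprema. One writes $x\ll y$ ($x$ is way below $y$) iff for every directed $D$ having a supremum, $y\le\sup D$ implies $x\le d$ for some $d\in D$ (so nothing is way below the least element). A continuous semilattice is a meet semilattice which is a dcpo and in which, for each $y$, the set $\{x\mid x\ll y\}$ is directed with supremum $y$. A subset of a dcpo is Scott closed if it is a lower set closed under suprema of its directed subsets; $\mathrm{Cl}(A)$ is the least Scott closed set containing $A$. A map between dcpos is Scott continuous iff it preserves suprema of directed sets. $\mathcal{S}em_0$ is the category of all continuous (meet) semilattices with zeros and all Scott continuous zero-preserving meet-preserving maps. For an object $S$, $S^\land$ is the set of all (possibly empty) Scott open filters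 in $S$ except $S$ itself, ordered by inclusion (a Scott open filter is an upper set $F$ closed under binary meets such that every non-empty directed set $D$ with $\sup D\in F$ meets $F$); $S^\land$ is a continuous semilattice with bottom $\varnothing$. For an arrow $f:S_1\to S_2$ put $f^\land(F)=f^{-1}(F)$, which is an arrow $f^\land:S_2^\land\to S_1^\land$ of $\mathcal{S}em_0$; $(-)^\land$ is a contravariant functor. The map $u_S(s)=\{F\in S^\land\mid s\in F\}$ is an isomorphism $S\to S^{\land\land}$, natural in $S$. For continuous semilattices $S_1,S_2$ with zeros, an ambiguous representation of $S_1$ in $S_2$ is a binary relation $R\subset S_1\times S_2$ such that (a) if $(x,y)\in R$, $x\le x'$ in $S_1$ and $y'\le y$ in $S_2$, then $(x',y')\in R$; (b) for all $x\in S_1$ the set $xR=\{y\in S_2\mid (x,y)\in R\}$ is non-empty and closed under directed suprema in $S_2$. It is called pseudo-invertible if: whenever $(x,y)\in R$ and $y'\ll y$ in $S_2$, there is $x'\ll x$ in $S_1$ such that $(x',y')\in R$. $\mathcal{S}em\mathcal{PR}$ is the category whose objects are continuous semilattices with zeros and whose arrows from $S_1$ to $S_2$ are the pseudo-invertible ambiguous representations $R\subset S_1\times S_2$; the composition of $R\subset S_1\times S_2$ and $Q\subset S_2\times S_3$ is $R{;}Q=\{(x,z)\mid z\in\mathrm{Cl}(xRQ)\}$, where $xRQ=\{z\mid\exists y\in S_2:\ (x,y)\in R,(y,z)\in Q\}$; identities are $E_S=\{(x,y)\in S\times S\mid y\le x\}$. The embedding $I:\mathcal{S}em_0\to\mathcal{S}em\mathcal{PR}$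 is $IS=S$, $If=\{(x,y)\in S_1\times S_2\mid y\le f(x)\}$. For $R\subset S_1\times S_2$, the pseudo-inverse is $$R^{\smile}=\{(G,F)\in S_2^\land\times S_1^\land\mid \text{for each }x\in F\text{ there is }y\in xR\text{ with }y\in G\}$$ (this is the pseudo-inverse with respect to the separating compatibilities $P_i:S_i\times S_i^\land\to\{0,1\}$, $P_i(x,F)=1\iff x\in F$), and $R^{\smile\smile}=(R^{\smile})^{\smile}$. *)

(* Defs.v *)
From HB Require Import structures.
From mathcomp Require Import all_boot all_order.
From mathcomp Require Import boolp classical_sets.

Set Implicit Arguments.
Unset Strict Implicit.
Unset Printing Implicit Defensive.

Import Order.TTheory.
Local Open Scope order_scope.
Local Open Scope classical_set_scope.

(* The empty set is directed: in a dcpo every directed family, possibly empty,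
   has a supremum, and nothing is way below the least element. *)
Definition directed d (T : porderType d) (D : set T) : Prop :=
  forall x y, D x -> D y -> exists z, [/\ D z, x <= z & y <= z].

Definition way_below d (T : porderType d) (x y : T) : Prop :=
  forall (D : set T) (s : T), directed D -> isLub D s -> y <= s ->
    exists2 e, D e & x <= e.

HB.mixin Record BMeetSemilattice_isContinuous d T
    of Order.BMeetSemilattice d T := {
  directed_complete : forall D : set T, directed D -> exists s, isLub D s;
  way_below_directed : forall y : T, directed [set x | way_below x y];
  way_below_isLub : forall y : T, isLub [set x | way_below x y] y
}.

#[short(type="contSemilatticeType")]
HB.structure Definition ContSemilattice d :=
  { T of Order.BMeetSemilattice d T & BMeetSemilattice_isContinuous d T }.

Definition upper_set d (T : porderType d) (A : set T) : Prop :=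
  forall x y, x <= y -> A x -> A y.

Definition lower_set d (T : porderType d) (A : set T) : Prop :=
  forall x y, x <= y -> A y -> A x.

Definition closed_directed_sup d (T : porderType d) (A : set T) : Prop :=
  forall (D : set T) (s : T), D `<=` A -> directed D -> isLub D s -> A s.

Definition scott_closed d (T : porderType d) (A : set T) : Prop :=
  lower_set A /\ closed_directed_sup A.

Definition scott_closure d (T : porderType d) (A : set T) : set T :=
  smallest (@scott_closed d T) A.

Definition scott_continuous d d' (T : porderType d) (U : porderType d')
    (f : T -> U) : Prop :=
  forall (D : set T) (s : T), directed D -> isLub D s -> isLub (f @` D) (f s).

Definition scott_open_filter d (S : meetSemilatticeType d) (F : set S) : Prop :=
  [/\ upper_set F,
      forall x y, F x -> F y -> F (x `&` y)%O &
      forall (D : set S) (s : S), D !=set0 -> directed D -> isLub D s -> F s ->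
        exists2 e, D e & F e].

Section ContSemilatticeTheory.
Context {d : Order.disp_t} {S : contSemilatticeType d}.
Implicit Types (x y z : S) (A D F : set S).

Lemma way_belowW x y : way_below x y -> x <= y.
Proof.
move=> /(_ [set y] y); case=> //.
- by move=> ? ? -> ->; exists y.
- by split=> [? -> //|b]; apply.
- by move=> ? ->.
Qed.

Lemma way_below_le x x' y y' :
  x' <= x -> way_below x y -> y <= y' -> way_below x' y'.
Proof.
move=> x'x xy yy' D s dD sD y's.
have [e De xe] := xy D s dD sD (le_trans yy' y's).
by exists e => //; apply: le_trans xe.
Qed.

Lemma way_below_bot x : ~ way_below x \bot.
Proof.
move=> /(_ set0 \bot); case=> //; split=> // b _; exact: le0x.
Qed.

Lemma way_below_interp x z :
  way_below x z -> exists2 y, way_below x y & way_below y z.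
Proof.
move=> xz; pose D := [set w : S | exists2 y, way_below w y & way_below y z].
have dD : directed D.
  move=> w1 w2 [y1 wy1 yz1] [y2 wy2 yz2].
  have [y [yz y1y y2y]] := way_below_directed z _ _ yz1 yz2.
  have [w [wy w1w w2w]] := way_below_directed y w1 w2
    (way_below_le (lexx _) wy1 y1y) (way_below_le (lexx _) wy2 y2y).
  by exists w; split=> //; exists y.
have lD : isLub D z.
  split=> [w [y wy yz]|b bD].
    exact: le_trans (way_belowW wy) (way_belowW yz).
  apply: (way_below_isLub z).2 => y yz.
  by apply: (way_below_isLub y).2 => w wy; apply: bD; exists y.
have [w [y wy yz] xw] := xz _ _ dD lD (lexx z).
by exists y => //; apply: way_below_le xw wy (lexx _).
Qed.

Lemma scott_open_approx F y : scott_open_filter F -> F y -> y <> \bot ->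
  exists2 x, way_below x y & F x.
Proof.
move=> [_ _ oF] Fy yN; have ly := way_below_isLub y.
apply: (oF _ _ _ (way_below_directed y) ly Fy).
apply: contrapT => /nonemptyPn y0; apply: yN; apply/eqP; rewrite -lex0.
by apply: ly.2; rewrite y0.
Qed.

Lemma scott_open_proper F : scott_open_filter F -> F <> setT <-> ~ F \bot.
Proof.
move=> [uF _ _]; split=> [FT F0|F0 FT]; last by apply: F0; rewrite FT.
by apply: FT; apply/seteqP; split=> // x _; apply: uF F0; exact: le0x.
Qed.

(* Interpolating repeatedly, y >> f y >> f (f y) >> ... >> x. *)
Lemma scott_open_filter_between x y : way_below x y ->
  exists F, [/\ scott_open_filter F, ~ F \bot, F y & F `<=` [set z | x <= z]].
Proof.
move=> xy.
have /choice[f fP] (z : S) :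
    exists w, way_below x z -> way_below x w /\ way_below w z.
  have [/way_below_interp[w xw wz]|] := pselect (way_below x z).
    by exists w.
  by exists z.
pose a n := iter n f y.
have xa n : way_below x (a n) by elim: n => //= n /fP[].
have aS n : way_below (a n.+1) (a n) by have [] := fP _ (xa n).
have aD n k : a (n + k)%N <= a n.
  elim: k => [|k ih]; first by rewrite addn0.
  by rewrite addnS; apply: le_trans ih; apply: way_belowW.
exists [set z | exists n, a n <= z]; split=> /=.
- split.
  + by move=> u v uv [n au]; exists n; apply: le_trans uv.
  + move=> u v [n au] [m av]; exists (n + m)%N; rewrite lexI.
    by rewrite (le_trans (aD n m) au) addnC (le_trans (aD m n) av).
  + move=> D s _ dD sD [n an].
    have [e De ae] := aS n D s dD sD an.
    by exists e => //; exists n.+1.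
- move=> [n]; rewrite lex0 => /eqP an.
  by apply: (@way_below_bot x); rewrite -an.
- by exists 0%N.
- by move=> z [n]; apply: le_trans (way_belowW (xa n)).
Qed.

Lemma scott_closure_closed A : scott_closed (scott_closure A).
Proof.
split=> [x y xy Ay B BP|D s DA dD sD B BP].
  by have [[lB _] _] := BP; exact: lB xy (Ay B BP).
by have [[_ cB] _] := BP; apply: (cB D) => // e De; exact: DA De B BP.
Qed.

Lemma scott_closureE A : lower_set A ->
  scott_closure A = [set z | forall w, way_below w z -> A w].
Proof.
move=> lA; apply/seteqP; split=> [z /(_ [set z | forall w, way_below w z -> A w])|].
  apply; split; last first.
    by move=> y Ay w /way_belowW wy; apply: lA wy Ay.
  split=> [x y xy Ay w wx|D s DA dD sD w /way_below_interp[v wv vs]].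
    by apply: Ay; apply: way_below_le xy.
  have [e De ve] := vs D s dD sD (lexx s).
  by apply: (DA e De); apply: way_below_le ve.
move=> z Az.
apply: (scott_closure_closed A).2 (way_below_directed z) (way_below_isLub z).
by move=> w /Az Aw; apply: sub_gen_smallest.
Qed.

End ContSemilatticeTheory.

Record lawson d (S : contSemilatticeType d) := Lawson {
  lawson_set : set S;
  lawson_asbool : `[< scott_open_filter lawson_set /\ lawson_set <> setT >]
}.

Section LawsonOrder.
Context {d : Order.disp_t} {S : contSemilatticeType d}.
Implicit Types (F G : lawson S).

HB.instance Definition _ := [isSub for @lawson_set d S].
HB.instance Definition _ := [Choice of lawson S by <:].
HB.instance Definition _ := [SubChoice_isSubPOrder of lawson S by <: with d].

Lemma lawson_leP F G : F <= G <-> val F `<=` val G.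
Proof. by rewrite -subsetEset -Order.le_val. Qed.

Lemma lawson_filter F : scott_open_filter (val F).
Proof. by case: F => F /= /asboolP[]. Qed.

Lemma lawson_bot F : ~ val F \bot.
Proof. by case: F => F /= /asboolP[o /(scott_open_proper o)]. Qed.

Lemma lawson_subproof (F : set S) : scott_open_filter F -> ~ F \bot ->
  `[< scott_open_filter F /\ F <> setT >].
Proof. by move=> oF F0; apply/asboolP; split=> //; apply/scott_open_proper. Qed.

Definition mkLawson (F : set S) (oF : scott_open_filter F) (F0 : ~ F \bot) :
  lawson S := Lawson (lawson_subproof oF F0).

Lemma lawsonI_filter F G : scott_open_filter (val F `&` val G).
Proof.
have [uF mF oF] := lawson_filter F; have [uG mG oG] := lawson_filter G.
split.
- by move=> x y xy [Fx Gx]; split; [apply: uF Fx|apply: uG Gx].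
- by move=> x y [Fx Gx] [Fy Gy]; split; [apply: mF|apply: mG].
- move=> D s D0 dD sD [Fs Gs].
  have [e De Fe] := oF _ _ D0 dD sD Fs; have [e' De' Ge'] := oG _ _ D0 dD sD Gs.
  have [c [Dc ec e'c]] := dD _ _ De De'.
  by exists c => //; split; [apply: uF Fe|apply: uG Ge'].
Qed.

Definition lawson_meet F G : lawson S :=
  mkLawson (lawsonI_filter F G) (fun FG => lawson_bot FG.1).

Lemma lawson_lexI F G H : (F <= lawson_meet G H) = (F <= G) && (F <= H).
Proof.
apply/idP/andP => [/lawson_leP /= FGH|[/lawson_leP FG /lawson_leP FH]].
  by split; apply/lawson_leP => x /FGH[].
by apply/lawson_leP => x Fx; split; [apply: FG|apply: FH].
Qed.

HB.instance Definition _ :=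
  Order.POrder_isMeetSemilattice.Build d (lawson S) lawson_lexI.

Lemma set0_scott_open_filter : scott_open_filter (set0 : set S).
Proof. by split. Qed.

Definition lawson0 : lawson S := mkLawson set0_scott_open_filter (@id False).

Lemma lawson_le0x F : lawson0 <= F.
Proof. exact/lawson_leP. Qed.

HB.instance Definition _ := Order.hasBottom.Build d (lawson S) lawson_le0x.

Lemma bigcup_lawson_filter (D : set (lawson S)) : directed D ->
  scott_open_filter (\bigcup_(F in D) val F).
Proof.
move=> dD; split.
- move=> x y xy [F DF Fx]; exists F => //.
  by have [uF _ _] := lawson_filter F; apply: uF Fx.
- move=> x y [F DF Fx] [G DG Gy].
  have [H [DH /lawson_leP FH /lawson_leP GH]] := dD _ _ DF DG.
  exists H => //; have [_ mH _] := lawson_filter H.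
  by apply: mH; [apply: FH|apply: GH].
- move=> E s E0 dE sE [F DF Fs]; have [_ _ oF] := lawson_filter F.
  by have [e Ee Fe] := oF _ _ E0 dE sE Fs; exists e => //; exists F.
Qed.

Definition lawson_bigcup (D : set (lawson S)) (dD : directed D) : lawson S :=
  mkLawson (bigcup_lawson_filter dD) (fun '(ex_intro2 F _ F0) => lawson_bot F0).

Lemma lawson_bigcup_isLub (D : set (lawson S)) (dD : directed D) :
  isLub D (lawson_bigcup dD).
Proof.
split=> [F DF|G ubG]; apply/lawson_leP => x /=; first by exists F.
by move=> [F DF Fx]; apply: (lawson_leP _ _).1 (ubG _ DF) _ Fx.
Qed.

Lemma lawson_isLub (D : set (lawson S)) F : directed D -> isLub D F ->
  val F = \bigcup_(G in D) val G.
Proof.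
move=> dD [ubF lF]; have [ubU lU] := lawson_bigcup_isLub dD.
by rewrite (_ : F = lawson_bigcup dD)//; apply/le_anti; rewrite lF// lU.
Qed.

Lemma lawson_between (F : lawson S) x : val F x ->
  exists G : lawson S, val G x /\
    exists2 w, val F w & val G `<=` [set z | w <= z].
Proof.
move=> Fx; have [w wx Fw] : exists2 w, way_below w x & val F w.
  apply: (scott_open_approx _ Fx); first exact: lawson_filter.
  by move=> x0; rewrite x0 in Fx; exact: lawson_bot Fx.
have [G [oG G0 Gx Gw]] := scott_open_filter_between wx.
by exists (mkLawson oG G0); split=> //; exists w.
Qed.

Lemma lawson_way_belowW (F G : lawson S) w : val F w ->
  val G `<=` [set z | w <= z] -> way_below G F.
Proof.
move=> Fw Gw D H dD lH /lawson_leP FH.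
move: (FH _ Fw); rewrite (lawson_isLub dD lH) => -[E DE Ew].
exists E => //; apply/lawson_leP => z /Gw wz.
by have [uE _ _] := lawson_filter E; apply: uE Ew.
Qed.

Lemma lawson_approx_directed (F : lawson S) : directed
  [set G : lawson S | exists2 w, val F w & val G `<=` [set z | w <= z]].
Proof.
move=> G1 G2 [w1 Fw1 Gw1] [w2 Fw2 Gw2].
have [_ mF _] := lawson_filter F.
have [G [Gw [w Fw wG]]] := lawson_between (mF _ _ Fw1 Fw2).
have [uG _ _] := lawson_filter G.
exists G; split; first by exists w.
  by apply/lawson_leP => z /Gw1 /= wz; apply: uG Gw; apply: le_trans wz; apply: leIl.
by apply/lawson_leP => z /Gw2 /= wz; apply: uG Gw; apply: le_trans wz; apply: leIr.
Qed.

Lemma lawson_approx_isLub (F : lawson S) : isLub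
  [set G : lawson S | exists2 w, val F w & val G `<=` [set z | w <= z]] F.
Proof.
split=> [G [w Fw Gw]|H ubH].
  by apply/lawson_leP => z /Gw wz; have [uF _ _] := lawson_filter F; apply: uF Fw.
apply/lawson_leP => x /lawson_between[G [Gx [w Fw Gw]]].
by have /lawson_leP := ubH G (ex_intro2 _ _ w Fw Gw); apply.
Qed.

Lemma lawson_way_belowP (F G : lawson S) : way_below G F <->
  exists2 w, val F w & val G `<=` [set z | w <= z].
Proof.
split=> [GF|[w Fw Gw]]; last exact: lawson_way_belowW Gw.
have [H [w Fw Hw] /lawson_leP GH] :=
  GF _ _ (@lawson_approx_directed F) (lawson_approx_isLub F) (lexx F).
by exists w => // z /GH /Hw.
Qed.

Lemma lawson_way_belowE (F : lawson S) : [set G | way_below G F] =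
  [set G : lawson S | exists2 w, val F w & val G `<=` [set z | w <= z]].
Proof. by apply/seteqP; split=> G /lawson_way_belowP. Qed.

Lemma lawson_directed_complete (D : set (lawson S)) :
  directed D -> exists F, isLub D F.
Proof. by move=> dD; exists (lawson_bigcup dD); apply: lawson_bigcup_isLub. Qed.

Lemma lawson_way_below_directed (F : lawson S) :
  directed [set G | way_below G F].
Proof. by rewrite lawson_way_belowE; apply: lawson_approx_directed. Qed.

Lemma lawson_way_below_isLub (F : lawson S) : isLub [set G | way_below G F] F.
Proof. by rewrite lawson_way_belowE; apply: lawson_approx_isLub. Qed.

HB.instance Definition _ := BMeetSemilattice_isContinuous.Build d (lawson S)
  lawson_directed_complete lawson_way_below_directed lawson_way_below_isLub.

End LawsonOrder.

(* S^, the proper Scott open filters ordered by inclusion. *)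
Definition lawson_dual d (S : contSemilatticeType d) : contSemilatticeType d :=
  lawson S.

Record sem0_map d (S1 S2 : contSemilatticeType d) := Sem0Map {
  sem0_fun :> S1 -> S2;
  sem0_scott : scott_continuous sem0_fun;
  sem0_bot : sem0_fun \bot = \bot;
  sem0_meet : {morph sem0_fun : x y / (x `&` y)%O}
}.

Section LawsonMap.
Context {d : Order.disp_t} {S1 S2 : contSemilatticeType d}.
Variable f : sem0_map S1 S2.

Lemma sem0_le x y : x <= y -> f x <= f y.
Proof. by move=> /meet_idPl xy; rewrite -xy sem0_meet leIr. Qed.

Lemma preimage_scott_open (F : lawson_dual S2) :
  scott_open_filter (f @^-1` val F).
Proof.
have [uF mF oF] := lawson_filter F; split=> /=.
- by move=> x y /sem0_le fxy; apply: uF fxy.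
- by move=> x y Fx Fy; rewrite sem0_meet; apply: mF.
- move=> D s [e De] dD sD Fs.
  have [||_ [c Dc <-] Fc] := oF (f @` D) (f s) _ _ (@sem0_scott _ _ _ f _ _ dD sD) Fs.
  + by exists (f e), e.
  + move=> _ _ [x Dx <-] [y Dy <-]; have [z [Dz xz yz]] := dD _ _ Dx Dy.
    by exists (f z); split; [exists z|exact: sem0_le|exact: sem0_le].
  + by exists c.
Qed.

Lemma preimage_bot (F : lawson_dual S2) : ~ (f @^-1` val F) \bot.
Proof. by rewrite /preimage /= sem0_bot; apply: lawson_bot. Qed.

Definition lawson_map_fun (F : lawson_dual S2) : lawson_dual S1 :=
  mkLawson (preimage_scott_open F) (@preimage_bot F).

Lemma lawson_map_scott : scott_continuous lawson_map_fun.
Proof.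
move=> D F dD lF; have FE := lawson_isLub dD lF.
split=> [_ [G DG <-]|H ubH].
  by apply/lawson_leP => x /= Gx; rewrite FE; exists G.
apply/lawson_leP => x /=; rewrite /preimage /= FE => -[G DG Gx].
have /lawson_leP : lawson_map_fun G <= H by apply: ubH; exists G.
exact.
Qed.

Lemma lawson_map_bot : lawson_map_fun \bot = \bot.
Proof. exact: val_inj. Qed.

Lemma lawson_map_meet : {morph lawson_map_fun : F G / (F `&` G)%O}.
Proof. by move=> F G; apply: val_inj. Qed.

Definition lawson_map : sem0_map (lawson_dual S2) (lawson_dual S1) :=
  Sem0Map lawson_map_scott lawson_map_bot lawson_map_meet.

End LawsonMap.

Section LawsonUnit.
Context {d : Order.disp_t}.
Variable S : contSemilatticeType d.

Lemma lawson_unit_filter (s : S) :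
  scott_open_filter [set F : lawson_dual S | val F s].
Proof.
split=> /=.
- by move=> F G /lawson_leP; apply.
- by move=> F G.
- move=> D F _ dD lF; rewrite (lawson_isLub dD lF) => -[G DG Gs].
  by exists G.
Qed.

Lemma lawson_unit_notbot (s : S) : ~ [set F : lawson_dual S | val F s] \bot.
Proof. by []. Qed.

Definition lawson_unit_fun (s : S) : lawson_dual (lawson_dual S) :=
  mkLawson (lawson_unit_filter s) (@lawson_unit_notbot s).

Lemma lawson_unit_le (x y : S) : x <= y -> lawson_unit_fun x <= lawson_unit_fun y.
Proof.
move=> xy; apply/lawson_leP => F /= Fx.
by have [uF _ _] := lawson_filter F; apply: uF Fx.
Qed.

Lemma lawson_unit_scott : scott_continuous lawson_unit_fun.
Proof.
move=> D s dD sD; split=> [_ [x Dx <-]|H ubH].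
  by apply: lawson_unit_le; exact: (sD.1 _ Dx).
apply/lawson_leP => F /= Fs.
have [D0|D0] := pselect (D !=set0); last first.
  case: (@lawson_bot d S F); suff <- : s = \bot by [].
  apply/eqP; rewrite -lex0; apply: (sD.2 \bot) => x Dx.
  by case: D0; exists x.
have [_ _ oF] := lawson_filter F; have [e De Fe] := oF _ _ D0 dD sD Fs.
have /lawson_leP : lawson_unit_fun e <= H by apply: ubH; exists e.
exact.
Qed.

Lemma lawson_unit_bot : lawson_unit_fun \bot = \bot.
Proof.
by apply: val_inj; apply/seteqP; split=> F //= /lawson_bot.
Qed.

Lemma lawson_unit_meet : {morph lawson_unit_fun : x y / (x `&` y)%O}.
Proof.
move=> x y; apply: val_inj; apply/seteqP; split=> F /=.
  have [uF _ _] := lawson_filter F.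
  by move=> Fxy; split; apply: uF Fxy; [apply: leIl|apply: leIr].
by have [_ mF _] := lawson_filter F; case; apply: mF.
Qed.

Definition lawson_unit : sem0_map S (lawson_dual (lawson_dual S)) :=
  Sem0Map lawson_unit_scott lawson_unit_bot lawson_unit_meet.

End LawsonUnit.

(* A relation R between S1 and S2 is represented by x |-> xR, so that R x is
   the set xR and R x y means that (x, y) is in R. *)
Definition ambiguous_representation d (S1 S2 : contSemilatticeType d)
    (R : S1 -> set S2) : Prop :=
  (forall x x' y y', R x y -> x <= x' -> y' <= y -> R x' y') /\
  (forall x, R x !=set0 /\ closed_directed_sup (R x)).

Definition pseudo_invertible d (S1 S2 : contSemilatticeType d)
    (R : S1 -> set S2) : Prop :=
  forall x y y', R x y -> way_below y' y -> exists2 x', way_below x' x & R x' y'.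

Record pirep d (S1 S2 : contSemilatticeType d) := PIRep {
  graph : S1 -> set S2;
  pirep_ambiguous : ambiguous_representation graph;
  pirep_invertible : pseudo_invertible graph
}.

Definition pseudo_inverse d (S1 S2 : contSemilatticeType d)
    (R : S1 -> set S2) : lawson_dual S2 -> set (lawson_dual S1) :=
  fun G => [set F | forall x, val F x -> exists2 y, R x y & val G y].

Definition rel_comp d (S1 S2 S3 : contSemilatticeType d)
    (R : S1 -> set S2) (Q : S2 -> set S3) : S1 -> set S3 :=
  fun x => scott_closure (\bigcup_(y in R x) Q y).

Section SemPRComposition.
Context {d : Order.disp_t}.
Implicit Types S : contSemilatticeType d.

Lemma pirep_inj S1 S2 (R Q : pirep S1 S2) :
  (forall x y, graph R x y <-> graph Q x y) -> R = Q.
Proof.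
case: R Q => [R aR iR] [Q aQ iQ] /= RQ.
have {}RQ : R = Q by apply/funext => x; apply/seteqP; split=> y /RQ.
case: _ / RQ aQ iQ => aQ iQ.
by rewrite (Prop_irrelevance aR aQ) (Prop_irrelevance iR iQ).
Qed.

Lemma graph_lower S1 S2 (R : pirep S1 S2) x : lower_set (graph R x).
Proof.
by move=> y' y y'y Rxy; apply: (pirep_ambiguous R).1 Rxy (lexx x) y'y.
Qed.

Lemma graph_upper S1 S2 (R : pirep S1 S2) x x' y :
  x <= x' -> graph R x y -> graph R x' y.
Proof. by move=> xx' Rxy; apply: (pirep_ambiguous R).1 Rxy xx' (lexx y). Qed.

Lemma graph_closed S1 S2 (R : pirep S1 S2) x y :
  (forall y', way_below y' y -> graph R x y') -> graph R x y.
Proof.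
move=> Rx; have [_ cR] := (pirep_ambiguous R).2 x.
exact: cR (way_below_directed y) (way_below_isLub y).
Qed.

Lemma rel_compP S1 S2 S3 (R : pirep S1 S2) (Q : pirep S2 S3) x z :
  rel_comp (graph R) (graph Q) x z <->
  forall w, way_below w z -> exists2 y, graph R x y & graph Q y w.
Proof.
rewrite /rel_comp scott_closureE; first by [].
by move=> w z' wz [y Ry Qy]; exists y => //; apply: graph_lower Qy.
Qed.

Lemma rel_comp_sub S1 S2 S3 (R : pirep S1 S2) (Q : pirep S2 S3) x y z :
  graph R x y -> graph Q y z -> rel_comp (graph R) (graph Q) x z.
Proof. by move=> Rxy Qyz; apply: sub_gen_smallest; exists y. Qed.

Lemma rel_comp_ambiguous S1 S2 S3 (R : pirep S1 S2) (Q : pirep S2 S3) :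
  ambiguous_representation (rel_comp (graph R) (graph Q)).
Proof.
split=> [x x' z z' /rel_compP RQ xx' z'z|x].
  apply/rel_compP => w wz'.
  have [y Ry Qy] := RQ _ (way_below_le (lexx w) wz' z'z).
  by exists y => //; apply: graph_upper Ry.
split; last exact: (scott_closure_closed _).2.
have [[y Rxy] _] := (pirep_ambiguous R).2 x.
have [[z Qyz] _] := (pirep_ambiguous Q).2 y.
by exists z; apply: rel_comp_sub Qyz.
Qed.

Lemma rel_comp_invertible S1 S2 S3 (R : pirep S1 S2) (Q : pirep S2 S3) :
  pseudo_invertible (rel_comp (graph R) (graph Q)).
Proof.
move=> x z z' /rel_compP RQ /way_below_interp[w z'w wz].
have [y Rxy Qyw] := RQ _ wz.
have [y' y'y Qy'z'] := pirep_invertible Qyw z'w.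
have [x' x'x Rx'y'] := pirep_invertible Rxy y'y.
by exists x' => //; apply: rel_comp_sub Qy'z'.
Qed.

Definition pirep_comp S1 S2 S3 (R : pirep S1 S2) (Q : pirep S2 S3) :
  pirep S1 S3 :=
  PIRep (rel_comp_ambiguous R Q) (@rel_comp_invertible _ _ _ R Q).

Lemma embed_ambiguous S1 S2 (f : sem0_map S1 S2) :
  ambiguous_representation (fun x => [set y | y <= f x]).
Proof.
split=> [x x' y y' /= yx /(sem0_le f) xx' y'y|x].
  exact: le_trans y'y (le_trans yx xx').
split; first by exists (f x) => /=.
by move=> D s Dx _ sD; apply: sD.2.
Qed.

Lemma embed_invertible S1 S2 (f : sem0_map S1 S2) :
  pseudo_invertible (fun x => [set y | y <= f x]).
Proof.
move=> x y y' /= yx y'y.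
have [|||_ [x' x'x <-] y'x'] := y'y (f @` [set x' | way_below x' x]) (f x).
- move=> _ _ [u ux <-] [v vx <-].
  have [w [wx uw vw]] := way_below_directed x _ _ ux vx.
  by exists (f w); split; [exists w|exact: sem0_le|exact: sem0_le].
- exact: (@sem0_scott _ _ _ f) _ _ (way_below_directed x) (way_below_isLub x).
- exact: yx.
- by exists x'.
Qed.

Definition embed S1 S2 (f : sem0_map S1 S2) : pirep S1 S2 :=
  PIRep (embed_ambiguous f) (@embed_invertible _ _ f).

Lemma pirep_id_ambiguous S : ambiguous_representation (fun x : S => [set y | y <= x]).
Proof.
split=> [x x' y y' /= yx xx' y'y|x]; first exact: le_trans y'y (le_trans yx xx').
split; first by exists x => /=.
by move=> D s Dx _ sD; apply: sD.2.
Qed.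

Lemma pirep_id_invertible S : pseudo_invertible (fun x : S => [set y | y <= x]).
Proof.
move=> x y y' /= yx /way_below_interp[w y'w wy].
by exists w; [apply: way_below_le yx|apply: way_belowW].
Qed.

Definition pirep_id S : pirep S S :=
  PIRep (@pirep_id_ambiguous S) (@pirep_id_invertible S).

Lemma pirep_comp1m S1 S2 (R : pirep S1 S2) : pirep_comp (pirep_id S1) R = R.
Proof.
apply: pirep_inj => x y; split=> [/rel_compP xy|Rxy].
  by apply: graph_closed => w /xy[x' /= x'x]; apply: graph_upper.
exact: (@rel_comp_sub _ _ _ (pirep_id S1) R x x y (lexx x) Rxy).
Qed.

Lemma pirep_compm1 S1 S2 (R : pirep S1 S2) : pirep_comp R (pirep_id S2) = R.
Proof.
apply: pirep_inj => x y; split=> [/rel_compP xy|Rxy].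
  by apply: graph_closed => w /xy[y' Ry' /= wy']; apply: graph_lower Ry'.
exact: (@rel_comp_sub _ _ _ R (pirep_id S2) x y y Rxy (lexx y)).
Qed.

Lemma pirep_compA S1 S2 S3 S4
    (R : pirep S1 S2) (Q : pirep S2 S3) (P : pirep S3 S4) :
  pirep_comp R (pirep_comp Q P) = pirep_comp (pirep_comp R Q) P.
Proof.
apply: pirep_inj => x t; split=> /rel_compP xt; apply/rel_compP => s /way_below_interp[r sr /xt].
  move=> [y Rxy /rel_compP /(_ _ sr)[z Qyz Pzs]].
  by exists z => //; apply: rel_comp_sub Qyz.
move=> [z /rel_compP RQ Pzr]; have [z' z'z Pz's] := pirep_invertible Pzr sr.
have [y Rxy Qyz'] := RQ _ z'z.
by exists y => //; apply: rel_comp_sub Pz's.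
Qed.

End SemPRComposition.

(* Composition is written in diagrammatic order. *)
Record category := Category {
  ob : Type;
  hom : ob -> ob -> Type;
  idm : forall a, hom a a;
  cmp : forall a b c, hom a b -> hom b c -> hom a c;
  cmp1m : forall a b (f : hom a b), cmp (idm a) f = f;
  cmpm1 : forall a b (f : hom a b), cmp f (idm b) = f;
  cmpA : forall a b c e (f : hom a b) (g : hom b c) (h : hom c e),
    cmp f (cmp g h) = cmp (cmp f g) h
}.

Definition is_iso (C : category) (a b : ob C) (f : hom a b) : Prop :=
  exists g : hom b a, cmp f g = idm a /\ cmp g f = idm b.

Definition is_contravariant_functor (C D : category) (F0 : ob C -> ob D)
    (F1 : forall a b, hom a b -> hom (F0 b) (F0 a)) : Prop :=
  (forall a, F1 a a (idm a) = idm (F0 a)) /\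
  (forall a b c (f : hom a b) (g : hom b c),
     F1 a c (cmp f g) = cmp (F1 b c g) (F1 a b f)).

Definition is_natural_iso (C D : category)
    (F0 : ob C -> ob D) (F1 : forall a b, hom a b -> hom (F0 a) (F0 b))
    (G0 : ob C -> ob D) (G1 : forall a b, hom a b -> hom (G0 a) (G0 b))
    (eta : forall a, hom (F0 a) (G0 a)) : Prop :=
  (forall a, is_iso (eta a)) /\
  (forall a b (f : hom a b), cmp (F1 a b f) (eta b) = cmp (eta a) (G1 a b f)).

(* The display d is only a printing tag, without mathematical content. *)
Definition SemPR (d : Order.disp_t) : category :=
  @Category (contSemilatticeType d) (@pirep d) (@pirep_id d) (@pirep_comp d)
    (@pirep_comp1m d) (@pirep_compm1 d) (@pirep_compA d).

(* Main.v *)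
(* Scott open filters separate points from their way-below approximants: if
   w << y then some proper Scott open filter lies between y and the up-set of w.
   This turns statements about R into statements about filters and back, and it
   makes u_S an order embedding.  For surjectivity, a proper Scott open filter P
   of S^ equals u_S(s) for s the supremum of the lower bounds of members of P. *)

Require Import Defs.
From mathcomp Require Import all_boot all_order.
From mathcomp Require Import boolp classical_sets.

Set Implicit Arguments.
Unset Strict Implicit.
Unset Printing Implicit Defensive.

Import Order.TTheory.
Local Open Scope order_scope.
Local Open Scope classical_set_scope.

(** * Approximation inside proper Scott open filters *)

Section LawsonFilters.
Context {d : Order.disp_t} {S : contSemilatticeType d}.
Implicit Types (x y : S) (F : lawson S).

Lemma lawson_up F x y : x <= y -> val F x -> val F y.
Proof. by move=> xy; have [uF _ _] := lawson_filter F; apply: uF. Qed.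

Lemma lawson_approx F y : val F y -> exists2 x, way_below x y & val F x.
Proof.
move=> Fy; apply: (scott_open_approx (lawson_filter F) Fy) => y0.
by rewrite y0 in Fy; exact: lawson_bot Fy.
Qed.

Lemma lawson_separation x y : way_below x y ->
  exists2 F : lawson S, val F y & val F `<=` [set z | x <= z].
Proof.
by move=> /scott_open_filter_between[F [oF F0 Fy Fx]]; exists (mkLawson oF F0).
Qed.

Lemma lawson_interp F x : val F x ->
  exists2 G : lawson S, way_below G F & val G x.
Proof.
move=> /lawson_between[G [Gx GF]]; exists G => //.
exact/lawson_way_belowP.
Qed.

End LawsonFilters.

(** * The unit is an order isomorphism *)

Section LawsonUnitIso.
Context {d : Order.disp_t} {S : contSemilatticeType d}.
Implicit Types x y : S.

Lemma lawson_unit_leE x y : (lawson_unit S x <= lawson_unit S y) = (x <= y).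
Proof.
apply/idP/idP => [/lawson_leP uxy|]; last exact: lawson_unit_le.
apply: (way_below_isLub x).2 => w /lawson_separation[F Fx Fw].
exact: Fw (uxy F Fx).
Qed.

(** The separating filter is the witness: it contains [y] and is included in every filter containing
    [x]. *)
Lemma lawson_unit_way_below x y : way_below x y ->
  way_below (lawson_unit S x) (lawson_unit S y).
Proof.
move=> /lawson_separation[F Fy Fx]; apply/lawson_way_belowP; exists F => //.
move=> G /= Gx; apply/lawson_leP => z /Fx xz; exact: lawson_up Gx.
Qed.

Lemma lawson_unit_surj (P : lawson_dual (lawson_dual S)) :
  exists s, lawson_unit S s = P.
Proof.
pose D := [set w : S |
  exists2 F : lawson_dual S, val P F & val F `<=` [set z | w <= z]].
have dD : directed D.
  move=> w1 w2 [F1 PF1 Fw1] [F2 PF2 Fw2].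
  have [_ mP _] := lawson_filter P.
  (* A member of [P] way below the meet of [F1] and [F2] has a lower bound in both, hence above [w1]
     and [w2]. *)
  have [F /lawson_way_belowP[w [Fw1w Fw2w] Fw] PF] :=
    lawson_approx (mP _ _ PF1 PF2).
  by exists w; split; [exists F|exact: Fw1|exact: Fw2].
have [s sD] := directed_complete D dD; exists s.
apply: val_inj; apply/seteqP; split=> F /=.
  move=> Fs; have [_ _ oF] := lawson_filter F.
  (* Openness of [F] concerns non-empty directed sets only; were [D] empty, [s] would be [\bot],
     which [F] omits. *)
  have D0 : D !=set0.
    apply: contrapT => /nonemptyPn D0; apply: (@lawson_bot _ _ F).
    by apply: lawson_up Fs; apply: sD.2; rewrite D0.
  have [w [G PG Gw] Fw] := oF _ _ D0 dD sD Fs.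
  apply: lawson_up PG; apply/lawson_leP => z /Gw wz; exact: lawson_up Fw.
move=> /lawson_approx[G /lawson_way_belowP[w Fw Gw] PG].
by apply: lawson_up Fw; apply: sD.1; exists G.
Qed.

End LawsonUnitIso.

(** * Functoriality of the pseudo-inverse, bidual and naturality *)

Section PseudoInverse.
Context {d : Order.disp_t}.
Implicit Types S : contSemilatticeType d.

Lemma pseudo_inverse_ambiguous S1 S2 (R : pirep S1 S2) :
  ambiguous_representation (pseudo_inverse (graph R)).
Proof.
split=> [G G' F F' RGF /lawson_leP GG' /lawson_leP F'F x /F'F /RGF[y Rxy Gy]|G].
  by exists y => //; apply: GG'.
split; first by exists \bot.
move=> D F DR dD lF x; rewrite (lawson_isLub dD lF) => -[H DH Hx].
exact: DR DH _ Hx.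
Qed.

(** A filter way below [F] lies above one point [w] of [F], so a single [y] related to [w] serves
    all of it, and [G] may shrink around that [y]. *)
Lemma pseudo_inverse_invertible S1 S2 (R : pirep S1 S2) :
  pseudo_invertible (pseudo_inverse (graph R)).
Proof.
move=> G F F' RGF /lawson_way_belowP[w /RGF[y Rwy Gy] F'w].
have [G' G'G G'y] := lawson_interp Gy; exists G' => // x /F'w wx.
by exists y => //; apply: graph_upper Rwy.
Qed.

Definition pirep_dual S1 S2 (R : pirep S1 S2) :
    pirep (lawson_dual S2) (lawson_dual S1) :=
  PIRep (pseudo_inverse_ambiguous R) (@pseudo_inverse_invertible _ _ R).

Lemma pirep_dual_embed S1 S2 (f : sem0_map S1 S2) :
  pirep_dual (embed f) = embed (lawson_map f).
Proof.
apply: pirep_inj => G F; split=> [fGF|/lawson_leP FG x Fx].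
  by apply/lawson_leP => x /fGF[y yfx]; apply: lawson_up.
by exists (f x) => /=; [exact: lexx|exact: FG].
Qed.

Lemma pirep_dual_id S : pirep_dual (pirep_id S) = pirep_id (lawson_dual S).
Proof.
apply: pirep_inj => G F; split=> [fGF|/lawson_leP FG x Fx].
  by apply/lawson_leP => x /fGF[y yx]; apply: lawson_up.
by exists x => /=; [exact: lexx|exact: FG].
Qed.

Lemma pirep_dual_comp S1 S2 S3 (R : pirep S1 S2) (Q : pirep S2 S3) :
  pirep_dual (pirep_comp R Q) = pirep_comp (pirep_dual Q) (pirep_dual R).
Proof.
apply: pirep_inj => H F; split=> [RQ|/rel_compP QR x Fx].
  apply/rel_compP => F' /lawson_way_belowP[w Fw F'w].
  have [z /rel_compP RQz Hz] := RQ w Fw.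
  (* Passing to [z1] strips the Scott closure; passing on to [z2] lets pseudo-invertibility of [Q]
     yield [y'] way below [y], leaving room for the middle filter [G]. *)
  have [z1 z1z Hz1] := lawson_approx Hz; have [y Rwy Qyz1] := RQz _ z1z.
  have [z2 z2z1 Hz2] := lawson_approx Hz1.
  have [y' /lawson_separation[G Gy Gy'] Qy'z2] := pirep_invertible Qyz1 z2z1.
  exists G => [v /Gy' y'v|x /F'w wx].
    by exists z2 => //; apply: graph_upper Qy'z2.
  by exists y => //; apply: graph_upper Rwy.
(* The closure on the dual side is stripped by an approximant of [F] that still contains [x]. *)
have [F' /QR[G QHG RGF'] F'x] := lawson_interp Fx.
have [y Rxy /QHG[z Qyz Hz]] := RGF' x F'x.
by exists z => //; apply: rel_comp_sub Qyz.
Qed.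

(** Pseudo-invertibility leaves room for a filter around [x]; conversely [y] is recovered from its
    approximants, as each row of [R] is closed under directed suprema. *)
Lemma pseudo_inverse_bidual S1 S2 (R : pirep S1 S2) x y :
  graph R x y <->
  pseudo_inverse (pseudo_inverse (graph R)) (lawson_unit S1 x) (lawson_unit S2 y).
Proof.
split=> [Rxy G /= /lawson_approx[y' y'y Gy']|RR].
  have [x' /lawson_separation[F Fx Fx'] Rx'y'] := pirep_invertible Rxy y'y.
  exists F => // v /Fx' x'v.
  by exists y' => //; apply: graph_upper Rx'y'.
apply: graph_closed => y' /lawson_separation[G Gy Gy'].
have [F RGF Fx] := RR G Gy; have [v Rxv /Gy' y'v] := RGF x Fx.
exact: graph_lower Rxv.
Qed.

(** Since [f x] is the largest element related to [x], its row in [Q] contains the other rows and is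
    already Scott closed. *)
Lemma pirep_comp_embedl S1 S2 S3 (f : sem0_map S1 S2) (Q : pirep S2 S3) x z :
  graph (pirep_comp (embed f) Q) x z <-> graph Q (f x) z.
Proof.
split=> [/rel_compP fQ|Qfxz].
  by apply: graph_closed => w /fQ[y /= yfx]; apply: graph_upper.
exact: (@rel_comp_sub _ _ _ _ (embed f) _ _ _ _ (lexx (f x)) Qfxz).
Qed.

Lemma embed_iso S1 S2 (f : sem0_map S1 S2) :
  {mono f : x y / x <= y} -> (forall y, exists x, f x = y) ->
  @is_iso (SemPR d) _ _ (embed f).
Proof.
move=> fle /choice[g gK].
have fK x : g (f x) = x by apply/le_anti; rewrite -!fle gK lexx.
have gle x y : (g x <= y) = (x <= f y) by rewrite -fle gK.
have leg x y : (x <= g y) = (f x <= y) by rewrite -fle gK.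
have g_scott : scott_continuous g.
  move=> D s dD sD; split=> [_ [x Dx <-]|b ubb].
    by rewrite gle gK; apply: sD.1.
  rewrite gle; apply: sD.2 => x Dx.
  by rewrite -gle; apply: ubb; exists x.
have g_bot : g \bot = \bot by apply/eqP; rewrite -lex0 gle le0x.
have g_meet : {morph g : x y / (x `&` y)%O}.
  by move=> x y; rewrite -[RHS]fK sem0_meet !gK.
exists (embed (Sem0Map g_scott g_bot g_meet)).
split; apply: pirep_inj => x y; rewrite pirep_comp_embedl /=.
  by rewrite fK.
by rewrite gK.
Qed.

Lemma lawson_unit_iso S : @is_iso (SemPR d) _ _ (embed (lawson_unit S)).
Proof.
by apply: embed_iso => [x y|]; [exact: lawson_unit_leE|exact: lawson_unit_surj].
Qed.

Lemma lawson_unit_natural S1 S2 (R : pirep S1 S2) :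
  pirep_comp R (embed (lawson_unit S2)) =
  pirep_comp (embed (lawson_unit S1)) (pirep_dual (pirep_dual R)).
Proof.
apply: pirep_inj => x P; have [y <-] := lawson_unit_surj P.
(* The right side becomes [graph R x y]; on the left the closure is tested on the images of
   approximants of [y]. *)
rewrite pirep_comp_embedl -[X in _ <-> X]pseudo_inverse_bidual.
split=> [/rel_compP RP|Rxy].
  apply: graph_closed => w /lawson_unit_way_below /RP[v Rxv /=].
  by rewrite lawson_unit_leE => wv; apply: graph_lower Rxv.
exact: (@rel_comp_sub _ _ _ _ _ (embed (lawson_unit S2)) _ _ _ Rxy (lexx _)).
Qed.

End PseudoInverse.

Theorem proposition3p0p4 (d : Order.disp_t) :
  exists Psi : forall S1 S2 : contSemilatticeType d,
      pirep S1 S2 -> pirep (lawson_dual S2) (lawson_dual S1),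
  [/\ (* R is sent to its pseudo-inverse *)
      forall (S1 S2 : contSemilatticeType d) (R : pirep S1 S2),
        graph (Psi S1 S2 R) = pseudo_inverse (graph R),
      (* contravariant functor, S |-> S^ on objects *)
      @is_contravariant_functor (SemPR d) (SemPR d) (@lawson_dual d) Psi,
      (* the square of Psi is isomorphic to the identity functor via u *)
      @is_natural_iso (SemPR d) (SemPR d)
        (fun S => S) (fun S1 S2 R => R)
        (fun S => lawson_dual (lawson_dual S))
        (fun S1 S2 R => Psi (lawson_dual S2) (lawson_dual S1) (Psi S1 S2 R))
        (fun S => embed (lawson_unit S)),
      forall (S1 S2 : contSemilatticeType d) (R : pirep S1 S2) (x : S1) (y : S2),
        graph R x y <->
        pseudo_inverse (pseudo_inverse (graph R))
          (lawson_unit S1 x) (lawson_unit S2 y)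
    & (* extension of the functor (-)^ *)
      forall (S1 S2 : contSemilatticeType d) (f : sem0_map S1 S2),
        Psi S1 S2 (embed f) = embed (lawson_map f)].
Proof.
exists (@pirep_dual d); split=> //.
- by split=> [S|S1 S2 S3 R Q]; [exact: pirep_dual_id|exact: pirep_dual_comp].
- by split=> [S|S1 S2 R]; [exact: lawson_unit_iso|exact: lawson_unit_natural].
- by move=> S1 S2 R x y; exact: pseudo_inverse_bidual.
- by move=> S1 S2 f; exact: pirep_dual_embed.
Qed.
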